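(* Let $\mathcal X,\mathcal Y_1,\mathcal Y_2$ be finite nonempty sets. For any prior $\pi$ on $\mathcal X$ and any channels $(\mathcal X,\mathcal Y_1,C_1)$ and $(\mathcal X,\mathcal Y_2,C_2)$: (1) $H_\infty(\pi,C_1\parallel C_2)\ \ge\ H_\infty(\pi,C_1)+H_\infty(\pi,C_2)-H^{\min}(\pi)$; (2) $H_\infty(\pi,C_1\parallel C_2)\ \le\ \min\{H_\infty(\pi,C_1),H_\infty(\pi,C_2)\}$; (3) $I_\infty(\pi,C_1\parallel C_2)\ \ge\ \max\{I_\infty(\pi,C_1),I_\infty(\pi,C_2)\}$; (4) $I_\infty(\pi,C_1\parallel C_2)\ \le\ I_\infty(\pi,C_1)+I_\infty(\pi,C_2)+H^{\min}(\pi)-H_\infty(\pi)$.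
   Context: A (discrete) channel $(\mathcal X,\mathcal Y,C)$ consists of finite sets $\mathcal X,\mathcal Y$ and a matrix $C$ with entries $C[x,y]\ge 0$ and $\sum_{y}C[x,y]=1$ for each $x$. A prior on $\mathcal X$ is a probability distribution on $\mathcal X$. The parallel composition with shared input $C_1\parallel C_2$ is the channel from $\mathcal X$ to $\mathcal Y_1\times\mathcal Y_2$ with $(C_1\parallel C_2)[x,(y_1,y_2)]=C_1[x,y_1]\,C_2[x,y_2]$. $V(\pi)=\max_{x}\pi[x]$, $V(\pi,C)=\sum_y\max_x\pi[x]C[x,y]$, $H_\infty(\pi)=-\log V(\pi)$, $H_\infty(\pi,C)=-\log V(\pi,C)$, and the min-entropy leakage is $I_\infty(\pi,C)=H_\infty(\pi)-H_\infty(\pi,C)$. Also $H^{\min}(\pi)=-\log\min\{\pi[x]: x\in\mathcal X,\ \pi[x]\ne0\}$. Logarithms are to base 2. *)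

(* Defs.v *)
From HB Require Import structures.
From mathcomp Require Import all_boot all_order all_algebra.
From mathcomp Require Import all_classical all_reals all_analysis.

Set Implicit Arguments.
Unset Strict Implicit.
Unset Printing Implicit Defensive.

Import Order.TTheory GRing.Theory Num.Theory.

Local Open Scope ring_scope.

Record prior (R : realType) (X : finType) := Prior {
  prior_fun :> X -> R;
  prior_ge0 : forall x, 0 <= prior_fun x;
  prior_sum1 : \sum_x prior_fun x = 1
}.

Record channel (R : realType) (X Y : finType) := Channel {
  channel_fun :> X -> Y -> R;
  channel_ge0 : forall x y, 0 <= channel_fun x y;
  channel_sum1 : forall x, \sum_y channel_fun x y = 1
}.

Section Parallel.
Variables (R : realType) (X Y1 Y2 : finType).
Variables (C1 : channel R X Y1) (C2 : channel R X Y2).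

Definition par_fun (x : X) (y : Y1 * Y2) : R := C1 x y.1 * C2 x y.2.

Lemma par_ge0 x y : 0 <= par_fun x y.
Proof. by rewrite mulr_ge0 ?channel_ge0. Qed.

Lemma par_sum1 x : \sum_y par_fun x y = 1.
Proof.
rewrite -(pair_bigA _ (fun y1 y2 => C1 x y1 * C2 x y2)) /=.
under eq_bigr do rewrite -mulr_sumr channel_sum1 mulr1.
exact: channel_sum1.
Qed.

Definition par : channel R X (Y1 * Y2)%type := Channel par_ge0 par_sum1.
End Parallel.

Section MinEntropy.
Variable R : realType.

Definition log2 (x : R) : R := ln x / ln 2.

Section Prior.
Variables (X : finType) (pi : prior R X).

(* All the entries are nonnegative and X is inhabited (the prior sums to 1),
   so the default value 0 of the iterated maxima does not affect them. *)
Definition vuln : R := \big[Num.max/0]_x pi x.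

Definition cond_vuln (Y : finType) (C : channel R X Y) : R :=
  \sum_y \big[Num.max/0]_x (pi x * C x y).

(* The support of the prior is nonempty and its probabilities are at most 1,
   so the default value 1 of the iterated minimum does not affect it. *)
Definition min_mass : R := \big[Num.min/1]_(x | pi x != 0) pi x.

Definition min_entropy : R := - log2 vuln.

Definition cond_min_entropy (Y : finType) (C : channel R X Y) : R :=
  - log2 (cond_vuln C).

Definition min_entropy_leakage (Y : finType) (C : channel R X Y) : R :=
  min_entropy - cond_min_entropy C.

Definition Hmin : R := - log2 min_mass.
End Prior.
End MinEntropy.

(* Main.v *)
(* The conditional vulnerability V satisfies
     max (V(pi,C1)) (V(pi,C2)) <= V(pi,C1||C2) <= V(pi,C1) * V(pi,C2) / m,
   where m is the least nonzero mass of pi. The lower bound holds because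
   summing pi[x] C1[x,y1] C2[x,y2] over y2 recovers pi[x] C1[x,y1], and a maximum
   of sums is at most the sum of the maxima; the upper bound holds because m <= pi[x]
   on the support, so that m pi[x] C1[x,y1] C2[x,y2] is at most the product of
   pi[x] C1[x,y1] and pi[x] C2[x,y2]. All four claims follow on taking logarithms. *)

Require Import Defs.
From HB Require Import structures.
From mathcomp Require Import all_boot all_order all_algebra.
From mathcomp Require Import all_classical all_reals all_analysis.
From mathcomp Require Import lra.

Set Implicit Arguments.
Unset Strict Implicit.
Unset Printing Implicit Defensive.

Import Order.TTheory GRing.Theory Num.Theory.

Local Open Scope ring_scope.

Section Log2.
Variable R : realType.

Lemma ln2_gt0 : 0 < ln 2 :> R.
Proof. by rewrite ln_gt0 // ltr1n. Qed.

Lemma ler_log2 (x y : R) : 0 < x -> x <= y -> log2 x <= log2 y.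
Proof.
move=> x0 xy; rewrite /log2 ler_pM2r ?invr_gt0 ?ln2_gt0 //.
by rewrite ler_ln ?posrE // (lt_le_trans x0).
Qed.

Lemma log2M (x y : R) : 0 < x -> 0 < y -> log2 (x * y) = log2 x + log2 y.
Proof. by move=> x0 y0; rewrite /log2 lnM ?posrE // mulrDl. Qed.
End Log2.

Section Vulnerability.
Variables (R : realType) (X : finType) (pi : prior R X).

Lemma min_mass_gt0 : 0 < min_mass pi.
Proof. by apply: lt_bigmin => // x pix; rewrite lt0r pix prior_ge0. Qed.

Lemma min_mass_le x : pi x != 0 -> min_mass pi <= pi x.
Proof. by move=> pix; exact: bigmin_le_cond. Qed.

(** Since row [x] of [C] sums to 1, [pi x] splits into the entries [pi x * C x y], each at most the
    maximum of its column. *)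
Lemma le_cond_vuln (Y : finType) (C : channel R X Y) x :
  pi x <= cond_vuln pi C.
Proof.
rewrite -[pi x]mulr1 -(channel_sum1 C x) mulr_sumr.
by apply: ler_sum => y _; exact: (le_bigmax _ (fun x => pi x * C x y)).
Qed.

Lemma cond_vuln_gt0 (Y : finType) (C : channel R X Y) : 0 < cond_vuln pi C.
Proof.
have [x pix] : exists x, 0 < pi x.
  apply/existsP; apply: contraT; rewrite negb_exists => /forallP pi_le0.
  have := ltr01 (R := R); rewrite -(prior_sum1 pi) ltNge sumr_le0 // => x _.
  by rewrite leNgt.
exact: lt_le_trans pix (le_cond_vuln C x).
Qed.

Variables (Y1 Y2 : finType) (C1 : channel R X Y1) (C2 : channel R X Y2).

Lemma cond_vuln_par_gel : cond_vuln pi C1 <= cond_vuln pi (par C1 C2).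
Proof.
rewrite /cond_vuln.
rewrite -(pair_bigA _ (fun y1 y2 => \big[Num.max/0]_x (pi x * (C1 x y1 * C2 x y2)))).
apply: ler_sum => y1 _; apply: bigmax_le => [|x _].
  by apply: sumr_ge0 => y2 _; exact: bigmax_ge_id.
rewrite -[C1 x y1]mulr1 -(channel_sum1 C2 x) !mulr_sumr.
by apply: ler_sum => y2 _; exact: (le_bigmax _ (fun x => pi x * (C1 x y1 * C2 x y2))).
Qed.

Lemma cond_vuln_par_ger : cond_vuln pi C2 <= cond_vuln pi (par C1 C2).
Proof.
rewrite /cond_vuln.
rewrite -(pair_bigA _ (fun y1 y2 => \big[Num.max/0]_x (pi x * (C1 x y1 * C2 x y2)))).
(* With [y2] outermost, the inner sum over [y1] absorbs a row of [C1]. *)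
rewrite exchange_big /=.
apply: ler_sum => y2 _; apply: bigmax_le => [|x _].
  by apply: sumr_ge0 => y1 _; exact: bigmax_ge_id.
rewrite -[C2 x y2]mul1r -(channel_sum1 C1 x) mulr_suml mulr_sumr.
by apply: ler_sum => y1 _; exact: (le_bigmax _ (fun x => pi x * (C1 x y1 * C2 x y2))).
Qed.

Lemma cond_vuln_par_le :
  min_mass pi * cond_vuln pi (par C1 C2) <= cond_vuln pi C1 * cond_vuln pi C2.
Proof.
(* Dividing by [min_mass pi] makes both sides sums over pairs, to be compared term by term. *)
rewrite [X in X <= _]mulrC -ler_pdivlMr ?min_mass_gt0 //.
rewrite /cond_vuln big_distrlr /= pair_bigA /= mulr_suml.
apply: ler_sum => -[y1 y2] _ /=; apply: bigmax_le => [|x _].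
  by rewrite divr_ge0 ?mulr_ge0 ?bigmax_ge_id ?(ltW min_mass_gt0).
rewrite ler_pdivlMr ?min_mass_gt0 //.
have C1_ge0 := channel_ge0 C1 x y1; have C2_ge0 := channel_ge0 C2 x y2.
have pi_ge0 := prior_ge0 pi x.
(* The intermediate product uses the same [x] in both factors, whereas the two maxima may be
   attained at different inputs. *)
apply: (@le_trans _ _ ((pi x * C1 x y1) * (pi x * C2 x y2))); last first.
  apply: ler_pM; rewrite ?mulr_ge0 //.
    exact: (le_bigmax _ (fun x => pi x * C1 x y1)).
  exact: (le_bigmax _ (fun x => pi x * C2 x y2)).
(* Off the support [min_mass pi] does not bound [pi x] from below, but both sides vanish. *)
have [->|/min_mass_le m_le] := eqVneq (pi x) 0; first by rewrite !mul0r.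
by rewrite mulrACA mulrAC; apply: ler_wpM2l => //; rewrite !mulr_ge0.
Qed.
End Vulnerability.

Theorem corollary4p4 (R : realType) (X Y1 Y2 : finType)
    (X_gt0 : (0 < #|X|)%N) (Y1_gt0 : (0 < #|Y1|)%N) (Y2_gt0 : (0 < #|Y2|)%N)
    (pi : prior R X) (C1 : channel R X Y1) (C2 : channel R X Y2) :
  [/\ cond_min_entropy pi (par C1 C2) >=
        cond_min_entropy pi C1 + cond_min_entropy pi C2 - Hmin pi,
      cond_min_entropy pi (par C1 C2) <=
        Num.min (cond_min_entropy pi C1) (cond_min_entropy pi C2),
      min_entropy_leakage pi (par C1 C2) >=
        Num.max (min_entropy_leakage pi C1) (min_entropy_leakage pi C2)
    & min_entropy_leakage pi (par C1 C2) <=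
        min_entropy_leakage pi C1 + min_entropy_leakage pi C2
          + Hmin pi - min_entropy pi].
Proof.
have V1 := cond_vuln_gt0 pi C1; have V2 := cond_vuln_gt0 pi C2.
have V12 := cond_vuln_gt0 pi (par C1 C2); have m0 := min_mass_gt0 pi.
have le1 := ler_log2 V1 (cond_vuln_par_gel pi C1 C2).
have le2 := ler_log2 V2 (cond_vuln_par_ger pi C1 C2).
(* In logarithms the product bound becomes linear, and claims (1) and (4) are rearrangements of
   it. *)
have := ler_log2 (mulr_gt0 m0 V12) (cond_vuln_par_le pi C1 C2).
rewrite !log2M // => le12.
rewrite /min_entropy_leakage /cond_min_entropy /Hmin; split.
- lra.
- by rewrite le_min !lerN2 le1 le2.
- by rewrite ge_max !lerD2l !opprK le1 le2.
- lra.
Qed.
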